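(* Let $n\ge 1$. The set of all $(\lambda_1,\dots,\lambda_n)\in\mathbb{R}^n$ for which there exists an $n\times n$ real matrix with all entries nonnegative whose eigenvalues, counted with algebraic multiplicity, are $\lambda_1,\dots,\lambda_n$ (in some order) is a semi-algebraic subset of $\mathbb{R}^n$.
   Context: A semi-algebraic subset of $\mathbb{R}^n$ is a set of the form $\bigcup_{i=1}^s\bigcap_{j=1}^{r_i}\{x\in\mathbb{R}^n : f_{i,j}(x) *_{i,j} 0\}$, where $f_{i,j}\in\mathbb{R}[X_1,\dots,X_n]$ and each $*_{i,j}$ is one of $>$, $\ge$, $=$. *)

(* Defs.v *)
From mathcomp Require Import all_boot all_order all_algebra.
From mathcomp Require Import complex.
From mathcomp Require Import classical_sets reals.
From mathcomp Require Import mpoly.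

Set Implicit Arguments.
Unset Strict Implicit.
Unset Printing Implicit Defensive.

Import Order.TTheory GRing.Theory Num.Theory.

Local Open Scope ring_scope.
Local Open Scope complex_scope.
Local Open Scope classical_set_scope.

Variant sign_rel := Positive | Nonnegative | Zero.

Definition sign_holds (R : realType) (c : sign_rel) (y : R) : bool :=
  match c with
  | Positive => 0 < y
  | Nonnegative => 0 <= y
  | Zero => y == 0
  end.

Definition semialgebraic (R : realType) (n : nat) (S : set 'rV[R]_n) : Prop :=
  exists (s : nat) (r : 'I_s -> nat)
         (f : forall i : 'I_s, 'I_(r i) -> {mpoly R[n]})
         (c : forall i : 'I_s, 'I_(r i) -> sign_rel),
    S = \bigcup_(i : 'I_s) \bigcap_(j : 'I_(r i))
          [set x : 'rV[R]_n |
            sign_holds (c i j) (f i j).@[fun k => x 0 k]].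

Definition nonnegative_mx (R : realType) (n : nat) (A : 'M[R]_n) : Prop :=
  forall i j, 0 <= A i j.

Definition algebraic_multiplicity (F : fieldType) (n : nat) (A : 'M[F]_n)
    (z : F) : nat :=
  mup z (char_poly A).

(* The eigenvalues of A are taken in the complex field R[i], so that a real
   list l with this property exhausts the complex spectrum of A. *)
Definition has_eigenvalues (R : realType) (n : nat) (A : 'M[R]_n)
    (l : 'rV[R]_n) : Prop :=
  forall z : R[i],
    algebraic_multiplicity (map_mx (real_complex R) A) z
      = #|[pred k : 'I_n | (l 0 k)%:C == z]|.

(* Main.v *)
Require Import Defs.
From mathcomp Require Import all_boot all_order all_algebra.
From mathcomp Require Import classical_sets reals.
From mathcomp Require Import perm complex mpoly polyrcf ordered_qelim qe_rcf.

(** A real list l is the full spectrum of A exactly when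
    det (t 1 - A) = prod_k (t - l_k) for every real t.  So the set of
    spectra of nonnegative matrices is defined by a first-order formula over
    the ordered field R: some n^2 numbers A_ij are all nonnegative and
    satisfy this equation for every t.  By the Tarski-Seidenberg theorem
    (quantifier elimination for real closed fields), every first-order
    formula is equivalent to a quantifier-free one, that is, to a boolean
    combination of polynomial sign conditions, and such combinations are
    semi-algebraic.

    Three facts carry the proof.  [semialgebraic_definable]: definable sets
    are semi-algebraic; it rests on quantifier elimination and on the
    stability of semi-algebraic sets under boolean operations, where
    complement is the point that needs an argument.  [has_eigenvaluesP]: the
    condition on complex multiplicities amounts to a factorization of the
    real characteristic polynomial.
    [holds_nonnegative_spectrum_formula]: the formula says what it should. *)

Set Implicit Arguments.
Unset Strict Implicit.
Unset Printing Implicit Defensive.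

Import Order.TTheory GRing.Theory Num.Theory.

Local Open Scope ring_scope.
Local Open Scope classical_set_scope.

(** * Boolean operations on semi-algebraic sets *)

Section SemialgebraicSets.
Variables (R : realType) (n : nat).
Implicit Types (S : set 'rV[R]_n) (x : 'rV[R]_n).

Definition sign_condition : Type := {mpoly R[n]} * sign_rel.

Definition satisfies x (a : sign_condition) : bool :=
  sign_holds a.2 a.1.@[fun k => x 0 k].

Definition dnf_set (d : seq (seq sign_condition)) : set 'rV[R]_n :=
  [set x | has (all (satisfies x)) d].

Lemma semialgebraic_dnf_set (d : seq (seq sign_condition)) :
  semialgebraic (dnf_set d).
Proof.
pose a0 : sign_condition := (0, Zero).
pose a (i : 'I_(size d)) (j : 'I_(size (nth [::] d i))) :=
  nth a0 (nth [::] d i) j.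
exists (size d), (fun i => size (nth [::] d i)),
  (fun i j => (a i j).1), (fun i j => (a i j).2).
apply/seteqP; split=> x /=.
  move=> /(has_nthP [::])[i lt_i /(all_nthP a0) d_x].
  by exists (Ordinal lt_i) => // j _; apply: d_x.
case=> i _ d_x; apply/(has_nthP [::]); exists i => //.
by apply/(all_nthP a0) => j lt_j; apply: (d_x (Ordinal lt_j)).
Qed.

(** Lists of lists of sign conditions replace the dependent families of the
    definition, so that unions and intersections become list operations and
    complements can be treated by induction. *)
Lemma semialgebraicP S : semialgebraic S <-> exists d, S = dnf_set d.
Proof.
split=> [[s [r [f [c ->]]]]|[d ->]]; last exact: semialgebraic_dnf_set.
exists [seq [seq (f i j, c i j) | j <- enum 'I_(r i)] | i <- enum 'I_s].
apply/seteqP; split=> x /=; rewrite /dnf_set /= has_map.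
  case=> i _ S_x; apply/hasP; exists i; rewrite ?mem_enum //= all_map.
  by apply/allP => j _; apply: S_x.
case/hasP=> i _ /=; rewrite all_map => /allP S_x.
by exists i => // j _; apply: S_x; rewrite mem_enum.
Qed.

Lemma semialgebraic_sign (p : {mpoly R[n]}) (c : sign_rel) :
  semialgebraic [set x | sign_holds c p.@[fun k => x 0 k]].
Proof.
apply/semialgebraicP; exists [:: [:: (p, c)]].
by apply/seteqP; split=> x; rewrite /dnf_set /= andbT orbF.
Qed.

Lemma semialgebraicT : semialgebraic [set: 'rV[R]_n].
Proof. by apply/semialgebraicP; exists [:: [::]]; apply/seteqP; split. Qed.

Lemma semialgebraic0 : semialgebraic (@set0 'rV[R]_n).
Proof. by apply/semialgebraicP; exists [::]; apply/seteqP; split. Qed.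

Lemma semialgebraicU S1 S2 :
  semialgebraic S1 -> semialgebraic S2 -> semialgebraic (S1 `|` S2).
Proof.
move=> /semialgebraicP[d1 ->] /semialgebraicP[d2 ->].
apply/semialgebraicP; exists (d1 ++ d2).
by apply/seteqP; split=> x; rewrite /dnf_set /= has_cat => /orP.
Qed.

(** Intersection distributes over union: the clauses of the intersection are
    the concatenations of one clause from each side. *)
Lemma semialgebraicI S1 S2 :
  semialgebraic S1 -> semialgebraic S2 -> semialgebraic (S1 `&` S2).
Proof.
move=> /semialgebraicP[d1 ->] /semialgebraicP[d2 ->].
apply/semialgebraicP; exists [seq c1 ++ c2 | c1 <- d1, c2 <- d2].
have dnfI x : has (all (satisfies x)) [seq c1 ++ c2 | c1 <- d1, c2 <- d2] =
    has (all (satisfies x)) d1 && has (all (satisfies x)) d2.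
  elim: d1 => //= c1 d1 IH; rewrite has_cat {}IH andb_orl; congr (_ || _).
  elim: d2 => [|c2 d2 IH] /=; first by rewrite andbF.
  by rewrite {}IH all_cat -andb_orr.
by apply/seteqP; split=> x; rewrite /dnf_set /= dnfI => /andP.
Qed.

(** Since R is totally ordered, the negations of p > 0 and of p >= 0 are sign
    conditions on - p, and that of p = 0 is the union of p > 0 and - p > 0. *)
Lemma semialgebraicC_sign (p : {mpoly R[n]}) (c : sign_rel) :
  semialgebraic [set x | ~~ sign_holds c p.@[fun k => x 0 k]].
Proof.
pose s q c' := semialgebraic_sign q c'.
case: c; [have := s (- p) Nonnegative | have := s (- p) Positive
  | have := semialgebraicU (s p Positive) (s (- p) Positive)];
  congr semialgebraic; apply/seteqP; split=> x /=;
  rewrite mevalN ?oppr_ge0 ?oppr_gt0 -?leNgt -?ltNge //.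
- by move=> /orP; rewrite orbC -neq_lt.
- by rewrite neq_lt orbC => /orP.
Qed.

(** De Morgan, applied first to the union of the clauses and then to the
    conditions of one clause. *)
Lemma semialgebraicC S : semialgebraic S -> semialgebraic (~` S).
Proof.
move=> /semialgebraicP[d ->]; elim: d => [|cl d IH].
  suff -> : ~` dnf_set [::] = [set: 'rV[R]_n] by exact: semialgebraicT.
  by apply/seteqP; split=> x.
have -> : ~` dnf_set (cl :: d) =
    [set x | ~~ all (satisfies x) cl] `&` ~` dnf_set d.
  apply/seteqP; split=> x; rewrite /dnf_set /=.
    by move=> /negP; rewrite negb_or => /andP[? /negP].
  by move=> [? /negP ?]; apply/negP; rewrite negb_or; apply/andP.
apply: semialgebraicI IH; elim: cl => [|[p c] cl IH] /=.
  by have := semialgebraic0; congr semialgebraic; apply/seteqP; split.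
have := semialgebraicU (semialgebraicC_sign p c) IH; congr semialgebraic.
by apply/seteqP; split=> x /=; rewrite negb_and => /orP.
Qed.

End SemialgebraicSets.

(** * Definable sets are semi-algebraic *)

Section DefinableSets.
Variables (R : realType) (n : nat).
Implicit Types (x : 'rV[R]_n) (t : GRing.term R) (f : ord.formula R).

Definition env x : seq R := codom (x 0).

Lemma size_env x : size (env x) = n.
Proof. by rewrite size_codom card_ord. Qed.

Lemma nth_env x (k : 'I_n) : nth 0 (env x) k = x 0 k.
Proof.
by rewrite /env codomE (nth_map k) ?size_enum_ord // nth_ord_enum.
Qed.

(** Division-free terms are polynomials.  A variable of index at least n
    evaluates to the default value 0, hence to the zero polynomial. *)
Lemma rterm_meval t : GRing.rterm t ->
  exists p : {mpoly R[n]},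
    forall x, p.@[fun k => x 0 k] = GRing.eval (env x) t.
Proof.
elim: t => //=.
- move=> i _; have [lt_in|le_ni] := ltnP i n.
    by exists 'X_(Ordinal lt_in) => x; rewrite mevalXU -nth_env.
  by exists 0 => x; rewrite meval0 nth_default ?size_env.
- by move=> c _; exists c%:MP => x; rewrite mevalC.
- by move=> k _; exists k%:R => x; rewrite rmorph_nat.
- move=> t1 IH1 t2 IH2 /andP[/IH1[p1 E1] /IH2[p2 E2]].
  by exists (p1 + p2) => x; rewrite mevalD E1 E2.
- by move=> t IH /IH[p E]; exists (- p) => x; rewrite mevalN E.
- by move=> t IH k /IH[p E]; exists (p *+ k) => x; rewrite mevalMn E.
- move=> t1 IH1 t2 IH2 /andP[/IH1[p1 E1] /IH2[p2 E2]].
  by exists (p1 * p2) => x; rewrite mevalM E1 E2.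
- by move=> t IH k /IH[p E]; exists (p ^+ k) => x; rewrite rmorphXn /= E.
Qed.

Lemma semialgebraic_sign_rterm (c : sign_rel) t : GRing.rterm t ->
  semialgebraic [set x | sign_holds c (GRing.eval (env x) t)].
Proof.
move=> /rterm_meval[p E]; have := semialgebraic_sign p c.
by congr semialgebraic; apply/seteqP; split=> x /=; rewrite E.
Qed.

Lemma semialgebraic_qf f : ord.qf_form f && ord.rformula f ->
  semialgebraic [set x | ord.qf_eval (env x) f].
Proof.
elim: f => //=.
- case=> _; [have := @semialgebraicT R n | have := @semialgebraic0 R n];
  by congr semialgebraic; apply/seteqP; split.
- move=> t1 t2 r12.
  have := semialgebraic_sign_rterm Zero (t := (t1 - t2)%T) r12.
  by congr semialgebraic; apply/seteqP; split=> x /=; rewrite subr_eq0.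
- move=> t1 t2; rewrite andbC => r21.
  have := semialgebraic_sign_rterm Positive (t := (t2 - t1)%T) r21.
  by congr semialgebraic; apply/seteqP; split=> x /=; rewrite subr_gt0.
- move=> t1 t2; rewrite andbC => r21.
  have := semialgebraic_sign_rterm Nonnegative (t := (t2 - t1)%T) r21.
  by congr semialgebraic; apply/seteqP; split=> x /=; rewrite subr_ge0.
- move=> f1 IH1 f2 IH2; rewrite andbACA => /andP[/IH1 S1 /IH2 S2].
  have := semialgebraicI S1 S2.
  by congr semialgebraic; apply/seteqP; split=> x /= /andP.
- move=> f1 IH1 f2 IH2; rewrite andbACA => /andP[/IH1 S1 /IH2 S2].
  have := semialgebraicU S1 S2.
  by congr semialgebraic; apply/seteqP; split=> x /= /orP.
- move=> f1 IH1 f2 IH2; rewrite andbACA => /andP[/IH1 S1 /IH2 S2].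
  have := semialgebraicU (semialgebraicC S1) S2.
  congr semialgebraic; apply/seteqP; split=> x /=; rewrite implybE.
    by case=> [/negP ->|->] //; rewrite orbT.
  by move=> /orP[/negP|]; [left | right].
- move=> f IH /IH /semialgebraicC.
  by congr semialgebraic; apply/seteqP; split=> x /= /negP.
Qed.

(** Tarski-Seidenberg: quantifier elimination leaves a quantifier-free formula
    whose terms are division-free. *)
Lemma semialgebraic_definable f : semialgebraic [set x | ord.holds (env x) f].
Proof.
have wf := ord.quantifier_elim_wf (@wf_QE_wproj R) (ord.to_rform_rformula f).
have := semialgebraic_qf wf; congr semialgebraic.
by apply/seteqP; split=> x /= /rcf_satP.
Qed.

End DefinableSets.

(** * The spectrum and the characteristic polynomial *)

Section Spectrum.
Variables (R : realType) (n : nat).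

Lemma count_real_complex (l : 'rV[R]_n) (z : R[i]) :
  #|[pred k : 'I_n | (real_complex R (l 0 k)) == z]| =
  count_mem z [seq real_complex R (l 0 k) | k <- enum 'I_n].
Proof.
rewrite cardE count_map -size_filter enumT /enum_mem.
by congr size; apply: eq_filter.
Qed.

(** Over the algebraically closed field R[i] the characteristic polynomial is
    the product of the X - z over its roots z with multiplicity, and the
    hypothesis identifies this multiset of roots with the entries of l.  The
    factorization descends to R because the embedding of R is injective. *)
Lemma has_eigenvaluesP (A : 'M[R]_n) (l : 'rV[R]_n) :
  has_eigenvalues A l <-> char_poly A = \prod_k ('X - (l 0 k)%:P).
Proof.
pose s := [seq real_complex R (l 0 k) | k <- enum 'I_n].
have map_prod : map_poly (real_complex R) (\prod_k ('X - (l 0 k)%:P)) =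
    \prod_(z <- s) ('X - z%:P).
  rewrite rmorph_prod big_map big_enum /=; apply: eq_bigr => k _.
  by rewrite rmorphB /= map_polyX map_polyC.
split=> [eig|charA z]; last first.
  rewrite /algebraic_multiplicity -map_char_poly charA map_prod.
  by rewrite mu_prod_XsubC count_real_complex.
apply: (@map_poly_inj _ _ (real_complex R)).
rewrite map_prod map_char_poly.
have [rs] := closed_field_poly_normal (char_poly (map_mx (real_complex R) A)).
rewrite (monicP (char_poly_monic _)) scale1r => def_rs.
rewrite def_rs; apply: perm_big; apply/allP => z _ /=; apply/eqP.
have := eig z; rewrite /algebraic_multiplicity def_rs mu_prod_XsubC => ->.
exact: count_real_complex.
Qed.

(** The first-order language speaks of reals and not of polynomials: this is
    what lets one universally quantified variable express an equality of
    polynomials. *)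
Lemma eq_poly_horner (p q : {poly R}) : p = q <-> forall t, p.[t] = q.[t].
Proof.
split=> [-> //|eq_pq]; apply/eqP; rewrite -subr_eq0; apply: contraT => nz_pq.
(* A nonzero p - q does not vanish at its own Cauchy bound. *)
have := @cauchy_boundP _ (p - q) (cauchy_bound (p - q)) nz_pq.
rewrite hornerD hornerN eq_pq subrr => /(_ erefl).
by rewrite ltNge ler_norm.
Qed.

Lemma horner_char_poly (A : 'M[R]_n) (t : R) :
  (char_poly A).[t] = \det (t%:M - A).
Proof.
rewrite /char_poly -horner_evalE -det_map_mx; congr (\det _).
apply/matrixP=> i j; rewrite !mxE /=.
by rewrite horner_evalE hornerD hornerN hornerC hornerMn hornerX.
Qed.

End Spectrum.

(** * A first-order formula for the spectra of nonnegative matrices *)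

Section NonnegativeSpectraFormula.
Variables (R : realType).
Implicit Types (e : seq R) (f : ord.formula R).

Lemma eval_bigA (I : Type) (r : seq I) (F : I -> GRing.term R) e :
  GRing.eval e (\big[@GRing.Add R/GRing.NatConst R 0]_(i <- r) F i)
  = \sum_(i <- r) GRing.eval e (F i).
Proof. exact: (big_morph (GRing.eval e)). Qed.

Lemma eval_bigM (I : Type) (r : seq I) (F : I -> GRing.term R) e :
  GRing.eval e (\big[@GRing.Mul R/GRing.NatConst R 1]_(i <- r) F i)
  = \prod_(i <- r) GRing.eval e (F i).
Proof. exact: (big_morph (GRing.eval e)). Qed.

(** The Leibniz formula, written out because terms do not form a ring in which
    the determinant could be taken. *)
Definition det_term (m : nat) (T : 'I_m -> 'I_m -> GRing.term R) :
    GRing.term R :=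
  \big[@GRing.Add R/GRing.NatConst R 0]_(s : 'S_m)
    (GRing.Const ((-1) ^+ s)%R *
     \big[@GRing.Mul R/GRing.NatConst R 1]_i T i (s i))%T.

Lemma eval_det_term (m : nat) (T : 'I_m -> 'I_m -> GRing.term R) e :
  GRing.eval e (det_term T) = \det (\matrix_(i, j) GRing.eval e (T i j)).
Proof.
rewrite eval_bigA; apply: eq_bigr => s _ /=; rewrite eval_bigM.
by congr (_ * _); apply: eq_bigr => i _; rewrite mxE.
Qed.

Lemma holds_bigA (I : eqType) (r : seq I) (F : I -> ord.formula R) e :
  ord.holds e (\big[@ord.And R/ord.Bool true]_(i <- r) F i) <->
  (forall i, i \in r -> ord.holds e (F i)).
Proof.
elim: r => [|i r IH]; first by rewrite big_nil.
rewrite big_cons /= IH; split=> [[Fi Fr] j|Fr].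
  by rewrite inE => /predU1P[->|/Fr].
by split=> [|j r_j]; apply: Fr; rewrite inE ?eqxx ?r_j ?orbT.
Qed.

Lemma set_nth_size e (x : R) : set_nth 0 e (size e) x = rcons e x.
Proof. by elim: e => //= y e ->. Qed.

(** The block of bound variables starts right after the variables of the
    environment, so each witness is appended at its end and no free variable
    is overwritten. *)
Lemma holds_foldr_Exists (m : nat) e f :
  ord.holds e (foldr (@ord.Exists R) f (iota (size e) m)) <->
  exists2 s, size s = m & ord.holds (e ++ s) f.
Proof.
elim: m e => [|m IH] e /=.
  split=> [f_e|[s /size0nil-> ]]; last by rewrite cats0.
  by exists [::]; rewrite ?cats0.
split=> [[x]|[[|x s] //= [sz_s] f_s]].
  rewrite set_nth_size -(size_rcons e x) => /IH[s sz_s f_s].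
  by exists (x :: s); rewrite /= ?sz_s // -cat_rcons.
exists x; rewrite set_nth_size -(size_rcons e x); apply/IH.
by exists s; rewrite ?cat_rcons.
Qed.

Variable n : nat.

(** Variables 0, ..., n - 1 hold the list l; the next n^2 hold the entries of
    A, numbered by the enumeration of the pairs of indices; the last one
    holds the argument t of the characteristic polynomial. *)
Let mx_var (i j : 'I_n) : GRing.term R := ('X_(n + enum_rank (i, j)))%T.

Let size_mx := #|{: 'I_n * 'I_n}|.

Let t_var : GRing.term R := ('X_(n + size_mx))%T.

Definition nonnegative_mx_formula : ord.formula R :=
  \big[@ord.And R/ord.Bool true]_(ij <- enum {: 'I_n * 'I_n})
    ord.Le (GRing.NatConst R 0) (mx_var ij.1 ij.2).

Definition char_poly_term : GRing.term R :=
  det_term (fun i j => t_var *+ (i == j)%B - mx_var i j)%T.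

Definition root_prod_term : GRing.term R :=
  \big[@GRing.Mul R/GRing.NatConst R 1]_(k <- enum 'I_n) (t_var - 'X_k)%T.

Definition char_poly_formula : ord.formula R :=
  ord.Forall (n + size_mx) (ord.Equal char_poly_term root_prod_term).

Definition nonnegative_spectrum_formula : ord.formula R :=
  foldr (@ord.Exists R)
    (ord.And nonnegative_mx_formula char_poly_formula) (iota n size_mx).

Lemma holds_mx_formula (l : 'rV[R]_n) (A : 'M[R]_n)
    (e := env l ++ codom (fun ij => A ij.1 ij.2)) :
  ord.holds e (ord.And nonnegative_mx_formula char_poly_formula) <->
  nonnegative_mx A /\ has_eigenvalues A l.
Proof.
have size_e : size e = (n + size_mx)%N by rewrite size_cat size_env size_codom.
have eval_l k : nth 0 e (nat_of_ord k) = l 0 k.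
  by rewrite nth_cat size_env ltn_ord nth_env.
have eval_A i j : nth 0 e (n + enum_rank (i, j)) = A i j.
  by rewrite nth_cat size_env ltnNge leq_addr addKn nth_codom enum_rankK.
have nonnegP : ord.holds e nonnegative_mx_formula <-> nonnegative_mx A.
  rewrite holds_bigA /=; split=> [A_ge0 i j|A_ge0 [i j] _]; last first.
    by rewrite /= eval_A; apply: A_ge0.
  by have /= := A_ge0 (i, j); rewrite eval_A mem_enum; apply.
have charP : ord.holds e char_poly_formula <-> has_eigenvalues A l.
  rewrite has_eigenvaluesP eq_poly_horner /=.
  have nth_e t i : (i < n + size_mx)%N -> nth 0 (rcons e t) i = nth 0 e i.
    by rewrite nth_rcons size_e => ->.
  have nth_t t : nth 0 (rcons e t) (n + size_mx) = t.
    by rewrite nth_rcons size_e ltnn eqxx.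
  have eval_char t :
      GRing.eval (rcons e t) char_poly_term = (char_poly A).[t].
    rewrite eval_det_term horner_char_poly; congr (\det _).
    apply/matrixP=> i j; rewrite !mxE /= nth_t.
    by rewrite nth_e ?eval_A // ltn_add2l.
  have eval_prod t :
      GRing.eval (rcons e t) root_prod_term = (\prod_k ('X - (l 0 k)%:P)).[t].
    rewrite eval_bigM horner_prod big_enum /=; apply: eq_bigr => k _.
    by rewrite /= nth_t nth_e ?eval_l ?ltn_addr // hornerXsubC.
  by split=> h t; have := h t; rewrite -size_e set_nth_size eval_char eval_prod.
by split=> -[/nonnegP ? /charP ?].
Qed.

Lemma holds_nonnegative_spectrum_formula (l : 'rV[R]_n) :
  ord.holds (env l) nonnegative_spectrum_formula <->
  exists A : 'M[R]_n, nonnegative_mx A /\ has_eigenvalues A l.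
Proof.
have := holds_foldr_Exists size_mx (env l)
  (ord.And nonnegative_mx_formula char_poly_formula).
rewrite size_env => ->; split=> [[s size_s hs]|[A /holds_mx_formula hA]].
  exists (\matrix_(i, j) nth 0 s (enum_rank (i, j))).
  apply/holds_mx_formula; set s' := codom _; suff -> : s' = s by [].
  apply: (@eq_from_nth _ 0); rewrite size_codom // => k lt_k.
  rewrite (nth_codom 0 _ (Ordinal lt_k)) mxE.
  by rewrite -surjective_pairing enum_valK.
by exists (codom (fun ij => A ij.1 ij.2)); rewrite ?size_codom.
Qed.

End NonnegativeSpectraFormula.

Theorem theorem3p2 (R : realType) (n : nat) (n_ge1 : (1 <= n)%N) :
  semialgebraic
    [set l : 'rV[R]_n |
      exists A : 'M[R]_n, nonnegative_mx A /\ has_eigenvalues A l].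
Proof.
have := semialgebraic_definable n (nonnegative_spectrum_formula R n).
congr semialgebraic; apply/seteqP.
by split=> l /= /holds_nonnegative_spectrum_formula.
Qed.
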